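(* Let $P$ be an arbitrary partially ordered set, and let $P^*$ be the set of all monotone mappings $P\to\mathbf{2}$, ordered pointwise. Then $P^*$ is a complete lattice with respect to the pointwise partial order.
   Context: $\mathbf{2}=\{0,1\}$ is the two-element partially ordered set with $0<1$. A mapping $x:P\to\mathbf{2}$ is monotone if $p\le q$ implies $x(p)\le x(q)$. The pointwise order on $P^*$ is: $x\le y$ iff $x(p)\le y(p)$ for all $p\in P$. A complete lattice is a partially ordered set in which every subset has a supremum and an infimum. *)

(* Defs.v *)
From HB Require Import structures.
From mathcomp Require Import all_boot all_order.
From mathcomp Require Import boolp classical_sets.

Set Implicit Arguments.
Unset Strict Implicit.
Unset Printing Implicit Defensive.

Import Order.TTheory.
Local Open Scope order_scope.
Local Open Scope classical_set_scope.

Section PointwiseOrder.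
Context {d d' : Order.disp_t} {P : porderType d} {Q : porderType d'}.
Implicit Types x y z : {omorphism P -> Q}.

HB.instance Definition _ := gen_eqMixin {omorphism P -> Q}.
HB.instance Definition _ := gen_choiceMixin {omorphism P -> Q}.

Lemma omorphism_inj x y : (x : P -> Q) = y -> x = y.
Proof.
case: x y => [f [[fh]]] [g [[gh]]] /= fg; case: _ / fg gh => gh.
by rewrite (Prop_irrelevance fh gh).
Qed.

(* The order inherited from the library's pointwise order on P -> Q. *)
Definition omorphism_le x y : bool := (x : P -> Q) <= (y : P -> Q).

Lemma omorphism_le_refl : reflexive omorphism_le.
Proof. by move=> x; rewrite /omorphism_le. Qed.

Lemma omorphism_le_anti : antisymmetric omorphism_le.
Proof. by move=> x y /le_anti /omorphism_inj. Qed.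

Lemma omorphism_le_trans : transitive omorphism_le.
Proof. by move=> y x z; apply: le_trans. Qed.

HB.instance Definition _ := Order.Le_isPOrder.Build
  FunOrder.fun_display {omorphism P -> Q}
  omorphism_le_refl omorphism_le_anti omorphism_le_trans.

Lemma omorphism_leP x y : reflect (forall p, x p <= y p) (x <= y).
Proof. exact: lefP. Qed.

End PointwiseOrder.

(* Every subset, including the empty one, has a supremum and an infimum. *)
Definition complete_lattice {d : Order.disp_t} (T : porderType d) : Prop :=
  forall A : set T, supremums A !=set0 /\ infimums A !=set0.

(* Main.v *)
Require Import Defs.
From HB Require Import structures.
From mathcomp Require Import all_boot all_order.
From mathcomp Require Import boolp classical_sets.

(** Suprema and infima of families of monotone maps can be computed pointwise.
    If [g p] is a supremum of the values [x p] for [x] in [A], then [g] is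
    again monotone: for [p <= q] every value satisfies [x p <= x q <= g q], so
    [g q] is an upper bound of the set of which [g p] is the least upper bound.
    Monotone maps into a complete lattice thus form a complete lattice
    ([complete_lattice_omorphism]), and the two-element chain is complete
    ([complete_lattice_bool]): a set of booleans has supremum true exactly when
    it contains true, and infimum true exactly when it omits false. *)

Set Implicit Arguments.
Unset Strict Implicit.
Unset Printing Implicit Defensive.

Import Order.TTheory.
Local Open Scope order_scope.
Local Open Scope classical_set_scope.

Section Pointwise.
Context {d d' : Order.disp_t} {P : porderType d} {Q : porderType d'}.
Implicit Types (A : set {omorphism P -> Q}) (g : P -> Q).

Lemma pointwise_supremum A g :
    (forall p, supremums [set (x : {omorphism P -> Q}) p | x in A] (g p)) ->
  supremums A !=set0.
Proof.
move=> gsup.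
have g_ub x p : A x -> x p <= g p.
  by move=> Ax; apply: (gsup p).1; exists x.
have g_mono : {homo g : p q / p <= q}.
  move=> p q pq; apply: (gsup p).2 => _ [x Ax <-].
  exact: le_trans (omorph_le x pq) (g_ub x q Ax).
pose gM := Order.isOrderMorphism.Build d P d' Q g g_mono.
pose G : {omorphism P -> Q} := HB.pack g gM.
exists G; split=> [x Ax|y y_ub]; apply/omorphism_leP => p; first exact: g_ub.
by apply: (gsup p).2 => _ [x Ax <-]; move/omorphism_leP: (y_ub x Ax); apply.
Qed.

Lemma pointwise_infimum A g :
    (forall p, infimums [set (x : {omorphism P -> Q}) p | x in A] (g p)) ->
  infimums A !=set0.
Proof.
move=> ginf.
have g_lb x p : A x -> g p <= x p.
  by move=> Ax; apply: (ginf p).1; exists x.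
have g_mono : {homo g : p q / p <= q}.
  move=> p q pq; apply: (ginf q).2 => _ [x Ax <-].
  exact: le_trans (g_lb x p Ax) (omorph_le x pq).
pose gM := Order.isOrderMorphism.Build d P d' Q g g_mono.
pose G : {omorphism P -> Q} := HB.pack g gM.
exists G; split=> [x Ax|y y_lb]; apply/omorphism_leP => p; first exact: g_lb.
by apply: (ginf p).2 => _ [x Ax <-]; move/omorphism_leP: (y_lb x Ax); apply.
Qed.

Lemma complete_lattice_omorphism :
  complete_lattice Q -> complete_lattice {omorphism P -> Q}.
Proof.
move=> Qcomplete A.
have values p := Qcomplete [set (x : {omorphism P -> Q}) p | x in A].
have [g gsup] := choice (fun p => (values p).1).
have [h hinf] := choice (fun p => (values p).2).
by split; [apply: pointwise_supremum gsup | apply: pointwise_infimum hinf].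
Qed.

End Pointwise.

Lemma complete_lattice_bool : complete_lattice bool.
Proof.
move=> B; split.
- exists `[< B true >]; split=> [[] Bb|b b_ub] //; first by rewrite asboolT.
  by case: asboolP => // /b_ub.
- exists `[< ~ B false >]; split=> [[] Bb|b b_lb]; first exact: lex1.
    by case: asboolP.
  by case: asboolP => [_|/contrapT /b_lb //]; apply: lex1.
Qed.

(* P is an arbitrary poset and {omorphism P -> bool}, with false < true and
   ordered pointwise, is P^*. *)
Theorem mainTheorem1 (d : Order.disp_t) (P : porderType d) :
  complete_lattice {omorphism P -> bool}.
Proof. exact: complete_lattice_omorphism complete_lattice_bool. Qed.
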